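(* Let $\mu,\{p_n\},\{t_n\},\{x_n\},\rho,\{r_n\},\{u_n\},\{\mathcal J_k\},\{\lambda_n\}$, the kernel $K(x,t)$ and the integral transformation $$(Ff)(t)=\int f(x)K(x,t)\,d\mu(x),\qquad f\in L^2(\mu),\ t\in\mathbb R,$$ be as in the context, and endow the range $F(L^2(\mu))$ with the inner product $\langle Ff,Fg\rangle_{F(L^2(\mu))}=\langle f,g\rangle_{L^2(\mu)}$. Then $F$ is a Hilbert space isomorphism mapping $L^2(\mu)$ onto $F(L^2(\mu))$ (in particular $F$ is injective, so the inner product is well defined), and $F(L^2(\mu))$ is a Hilbert space of functions on $\mathbb R$ with reproducing kernel $$k(t,s)=\int K(x,t)\overline{K(x,s)}\,d\mu(x).$$
   Context: Setting. $\mu$ is a positive measure on the real line and $\{p_n\}_{n\ge 0}$ is a complete orthonormal system in $L^2(\mu)$. $(t_j)_{j\ge0}$ is a sequence of distinct nonzero real numbers, $\rho(t_j)>0$, and $\{r_n\}_{n\ge0}$ is a system of functions satisfying $$\sum_{j=0}^{\infty}\rho(t_j)r_n(t_j)\overline{r_m(t_j)}=\delta_{mn},\qquad \sum_{k=0}^{\infty}r_k(t_n)\overline{r_k(t_m)}=\frac{\delta_{mn}}{\rho(t_n)},$$ and complete in the $\ell^2$ space of the discrete measure $\sum_j\rho(t_j)\delta_{t_j}$. $\{u_k\}_{k\ge0}$ is a sequence of complex numbers with $|u_k|=1$. Put $x_n=1/t_n$. Auxiliary functions. $\{\mathcal J_k\}_{k\ge0}$ is a sequence of complex-valued functions on $\mathbb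 R$ such that $\{\mathcal J_k(t)\}_{k\ge 0}\in\ell^2$ for every real $t$, and such that for a sequence $\{\lambda_n\}$ of nonzero real numbers (independent of $k$) $$\mathcal J_k(x_n)=\lambda_n\,r_k(1/x_n)\qquad\text{for all }k,n\ge0 .$$ Kernel. For $t\in\mathbb R$, $K(\cdot,t)=\sum_{k=0}^{\infty}\mathcal J_k(t)u_kp_k$, with convergence in $L^2(\mu)$. A function $k(t,s)$ is a reproducing kernel of a Hilbert space $H$ of functions on a set $X$ if $k(\cdot,s)\in H$ for every $s\in X$ and $f(s)=\langle f,k(\cdot,s)\rangle_H$ for every $f\in H$, $s\in X$. Inner products are linear in the first argument. *)

(* Defs.v *)
From HB Require Import structures.
From mathcomp Require Import all_boot all_order all_algebra ring_quotient.
From mathcomp Require Import all_classical all_reals all_analysis.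
From mathcomp.real_closed Require Import complex.
From mathcomp Require Import measurable_realfun lra.
Set Implicit Arguments.
Unset Strict Implicit.
Unset Printing Implicit Defensive.
Import Order.TTheory GRing.Theory Num.Theory.
Import numFieldNormedType.Exports.
Local Open Scope classical_set_scope.
Local Open Scope ring_scope.
Local Open Scope complex_scope.

(* Scalars are [R[i]] with [R : realType].  [cnorm z] is the modulus of [z] as
   an element of [R], whereas [`|z|] lies in [R[i]].  Limits of complex sequences
   are taken in the normed space [R[i]^o]. *)

Definition cnorm {R : realType} (z : R[i]) : R := ComplexField.Normc.normc z.

(* Hilbert spaces are given by a subset [H] of a complex vector space [V] and
   an inner product, linear in its first argument, which is only meaningful on
   [H].  This covers spaces of functions on a set [X] ([V := X -> R[i]]) whose
   inner product is not defined for all functions. *)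
Section hilbert.
Context {R : realType} {V : lmodType R[i]}.
Variables (H : set V) (dot : V -> V -> R[i]).

Definition hnorm (f : V) : R := Num.sqrt (complex.Re (dot f f)).

Definition hcvg (u : nat -> V) (l : V) : Prop :=
  hnorm (u n - l) @[n --> \oo] --> (0 : R).

Definition hcauchy (u : nat -> V) : Prop :=
  forall e : R, 0 < e -> exists N : nat,
    forall m n : nat, (N <= m)%N -> (N <= n)%N -> hnorm (u m - u n) < e.

(* [0 <= z] in [R[i]] means that [z] is real and nonnegative. *)
Definition is_hilbert : Prop :=
  [/\ H 0 /\ (forall a f g, H f -> H g -> H (a *: f + g)),
      forall a f g h, H f -> H g -> H h ->
        dot (a *: f + g) h = a * dot f h + dot g h,
      forall f g, H f -> H g -> dot g f = (dot f g)^*%R,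
      forall f, H f -> 0 <= dot f f /\ (dot f f = 0 -> f = 0) &
      forall u : nat -> V, (forall n, H (u n)) -> hcauchy u ->
        exists2 l, H l & hcvg u l].

Definition orthonormal_system (e : nat -> V) : Prop :=
  (forall n, H (e n)) /\ forall m n, dot (e m) (e n) = (m == n)%:R.

Definition complete_system (e : nat -> V) : Prop :=
  (forall n, H (e n)) /\
  forall f, H f -> forall eps : R, 0 < eps ->
    exists (n : nat) (c : nat -> R[i]),
      hnorm (f - \sum_(k < n) c k *: e k) < eps.

End hilbert.

Definition hilbert_iso {R : realType} {V W : lmodType R[i]}
    (H : set V) (dotH : V -> V -> R[i]) (G : set W) (dotG : W -> W -> R[i])
    (U : V -> W) : Prop :=
  [/\ is_hilbert H dotH, is_hilbert G dotG,
      forall a f g, H f -> H g -> U (a *: f + g) = a *: U f + U g,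
      set_bij H G U &
      forall f g, H f -> H g -> dotG (U f) (U g) = dotH f g].

(* The inner product [<U f, U g> := <f, g>] on the range of [U]; independent of
   the chosen preimages as soon as [U] is injective. *)
Definition range_dot {R : realType} {V W : lmodType R[i]}
    (dot : V -> V -> R[i]) (U : V -> W) (u v : W) : R[i] :=
  dot (xget 0 [set f | U f = u]) (xget 0 [set g | U g = v]).

Definition reproducing_kernel {R : realType} {X : Type}
    (H : set (X -> R[i])) (dot : (X -> R[i]) -> (X -> R[i]) -> R[i])
    (k : X -> X -> R[i]) : Prop :=
  (forall s, H (fun t => k t s)) /\
  forall f s, H f -> f s = dot f (fun t => k t s).

(* Square-summable sequences for the weights [w], and their inner product.
   For [w j = rho (t j)] with distinct [t j], the sequence [a] stands for the
   function [t j |-> a j] in the L^2 space of the discrete measure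
   [\sum_j rho (t j) \d_(t j)]. *)
Section weighted_l2.
Context {R : realType}.
Variable w : nat -> R.

Definition wl2 : set (nat -> R[i]) :=
  [set a | cvgn (series (fun j => w j * cnorm (a j) ^+ 2))].

Definition wl2_dot (a b : nat -> R[i]) : R[i] :=
  limn (series (fun j => (w j)%:C * a j * (b j)^*%R : R[i]^o)).

End weighted_l2.

Definition cintegral d (T : measurableType d) (R : realType)
    (mu : {measure set T -> \bar R}) (f : T -> R[i]) : R[i] :=
  (\int[mu]_x complex.Re (f x))%R +i* (\int[mu]_x complex.Im (f x))%R.

(* The complex space L^2(mu): square-integrable measurable functions modulo
   almost everywhere equality.  An element [f : L2 mu] coerces to a
   representative of its class. *)
Section square_integrable.
Context d (T : measurableType d) (R : realType).
Variable mu : {measure set T -> \bar R}.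

Definition sqint_set : set (T -> R[i]) :=
  [set f : T -> R[i] | [/\ measurable_fun setT (fun x => complex.Re (f x)),
                 measurable_fun setT (fun x => complex.Im (f x)) &
                 (\int[mu]_x (cnorm (f x) ^+ 2)%:E < +oo)%E]].

Definition sqint : {pred T -> R[i]} := mem sqint_set.

Lemma cnorm2E (z : R[i]) :
  cnorm z ^+ 2 = complex.Re z ^+ 2 + complex.Im z ^+ 2.
Proof. by case: z => a b /=; rewrite sqr_sqrtr// addr_ge0// sqr_ge0. Qed.

Lemma ReD (z z' : R[i]) : complex.Re (z + z') = complex.Re z + complex.Re z'.
Proof. by case: z z' => ? ? []. Qed.

Lemma ImD (z z' : R[i]) : complex.Im (z + z') = complex.Im z + complex.Im z'.
Proof. by case: z z' => ? ? []. Qed.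

Lemma ReM (a z : R[i]) : complex.Re (a * z) =
  complex.Re a * complex.Re z - complex.Im a * complex.Im z.
Proof. by case: a z => ? ? []. Qed.

Lemma ImM (a z : R[i]) : complex.Im (a * z) =
  complex.Re a * complex.Im z + complex.Im a * complex.Re z.
Proof. by case: a z => ? ? []. Qed.

Lemma measurable_cnorm2 (f : T -> R[i]) :
  measurable_fun setT (fun x => complex.Re (f x)) ->
  measurable_fun setT (fun x => complex.Im (f x)) ->
  measurable_fun setT (EFin \o (fun x => cnorm (f x) ^+ 2)).
Proof.
move=> mr mi; apply/measurable_EFinP; under eq_fun do rewrite cnorm2E.
by apply: measurable_funD; exact: measurable_funX.
Qed.

Lemma sqint_submod_closed : submod_closed sqint.
Proof.
split.
  rewrite inE; split; [exact: measurable_cst|exact: measurable_cst|].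
  under eq_integral => x _ do rewrite cnorm2E/= expr0n/= addr0.
  by rewrite integral0 ltry.
move=> a f g; rewrite !inE => -[mfr mfi If] [mgr mgi Ig].
have mr : measurable_fun setT (fun x => complex.Re ((a *: f + g) x)).
  under eq_fun do rewrite ReD ReM.
  by apply: measurable_funD => //; apply: measurable_funB;
    apply: measurable_funM.
have mi : measurable_fun setT (fun x => complex.Im ((a *: f + g) x)).
  under eq_fun do rewrite ImD ImM.
  by apply: measurable_funD => //; apply: measurable_funD;
    apply: measurable_funM.
split => //.
apply: (@le_lt_trans _ _ (\int[mu]_x ((2 * cnorm a ^+ 2)%:E *
    (cnorm (f x) ^+ 2)%:E + 2%:E * (cnorm (g x) ^+ 2)%:E))%E).
  apply: ge0_le_integral => //.
  - by move=> x _; rewrite lee_fin sqr_ge0.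
  - exact: measurable_cnorm2.
  - by apply: emeasurable_funD; apply: measurable_funeM;
      exact: measurable_cnorm2.
  - move=> x _; rewrite -!EFinM -EFinD lee_fin.
    rewrite -mulrA -exprMn -[cnorm a * _]ComplexField.Normc.normcM -/(cnorm _).
    change ((a *: f + g) x) with (a * f x + g x).
    move: (a * f x) (g x) => z z'; rewrite !cnorm2E ReD ImD.
    move: (complex.Re z) (complex.Im z) (complex.Re z') (complex.Im z').
    move=> p q p' q'; rewrite -subr_ge0.
    rewrite (_ : _ - _ = (p - p') ^+ 2 + (q - q') ^+ 2).
      by rewrite addr_ge0// sqr_ge0.
    by rewrite !sqrrB !sqrrD; lra.
have c0 : 0 <= 2 * cnorm a ^+ 2 by rewrite mulr_ge0// sqr_ge0.
rewrite ge0_integralD//.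
- rewrite ge0_integralZl_EFin//.
  + rewrite ge0_integralZl_EFin//.
    * by apply: lte_add_pinfty; apply: lte_mul_pinfty.
    * by move=> x _; rewrite lee_fin sqr_ge0.
    * exact: measurable_cnorm2.
  + by move=> x _; rewrite lee_fin sqr_ge0.
  + exact: measurable_cnorm2.
- by move=> x _; rewrite mule_ge0// lee_fin// sqr_ge0.
- by apply: measurable_funeM; exact: measurable_cnorm2.
- by move=> x _; rewrite mule_ge0// lee_fin// sqr_ge0.
- by apply: measurable_funeM; exact: measurable_cnorm2.
Qed.

HB.instance Definition _ :=
  GRing.isSubmodClosed.Build R[i] (T -> R[i]) sqint sqint_submod_closed.

Record sqint_fun := SqintFun {
  sqint_val :> T -> R[i]; sqint_valP : sqint_val \in sqint }.

HB.instance Definition _ := [isSub for sqint_val].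
HB.instance Definition _ := [Choice of sqint_fun by <:].
HB.instance Definition _ := [SubChoice_isSubLmodule of sqint_fun by <:].

Definition sqint_null : {pred sqint_fun} :=
  mem [set f : sqint_fun | {ae mu, forall x, f x = 0}].

Lemma sqint_null_submod_closed : submod_closed sqint_null.
Proof.
split; first by rewrite inE /=; exact: nearW.
move=> a f g; rewrite !inE /= => f0 g0.
apply: filterS2 f0 g0 => x fx gx.
by change (a * f x + g x = 0); rewrite fx gx mulr0 addr0.
Qed.

HB.instance Definition _ := GRing.isSubmodClosed.Build R[i] sqint_fun
  sqint_null sqint_null_submod_closed.

Definition L2 : Type := Quotient.quot sqint_null.
HB.instance Definition _ := Choice.on L2.
HB.instance Definition _ := EqQuotient.on L2.
HB.instance Definition _ := GRing.Zmodule.on L2.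

Local Open Scope quotient_scope.

Definition L2_fun (f : L2) : T -> R[i] := repr f.
Coercion L2_fun : L2 >-> Funclass.

Lemma L2_ae_eqP (f g : sqint_fun) :
  \pi_L2 f = \pi_L2 g <-> {ae mu, forall x, f x = g x}.
Proof.
split.
  move=> /eqP; rewrite -[_ == _]/(f == g %[mod L2]) -Quotient.idealrBE inE /=.
  apply: filterS => x h; apply/eqP; rewrite -subr_eq0; apply/eqP; exact: h.
move=> fg; apply/eqP; rewrite -[_ == _]/(f == g %[mod L2]).
rewrite -Quotient.idealrBE inE /=; apply: filterS fg => x h.
by change (f x - g x = 0); rewrite h subrr.
Qed.

Definition L2_scale (a : R[i]) (f : L2) : L2 := \pi_L2 (a *: repr f).

Lemma L2_scale_pi a (f : sqint_fun) :
  L2_scale a (\pi_L2 f) = \pi_L2 (a *: f).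
Proof.
apply/L2_ae_eqP; have /L2_ae_eqP : \pi_L2 (repr (\pi_L2 f)) = \pi_L2 f.
  by rewrite reprK.
apply: filterS => x h; change (a * repr (\pi_L2 f) x = a * f x).
by rewrite h.
Qed.

Let piD (f g : sqint_fun) : \pi_L2 f + \pi_L2 g = \pi_L2 (f + g).
Proof. exact: esym (Quotient.pi_add _ f g). Qed.

Let L2_pi (f : L2) : exists g, f = \pi_L2 g.
Proof. by exists (repr f); rewrite reprK. Qed.

Let L2_scaleA a b (f : L2) : L2_scale a (L2_scale b f) = L2_scale (a * b) f.
Proof. by have [g ->] := L2_pi f; rewrite 3!L2_scale_pi scalerA. Qed.

Let L2_scale1 : left_id 1 L2_scale.
Proof. by move=> f; have [g ->] := L2_pi f; rewrite L2_scale_pi scale1r. Qed.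

Let L2_scaleDr : right_distributive L2_scale +%R.
Proof.
move=> a f g; have [f' ->] := L2_pi f; have [g' ->] := L2_pi g.
by rewrite piD 3!L2_scale_pi piD scalerDr.
Qed.

Let L2_scaleDl (f : L2) : {morph L2_scale^~ f : a b / a + b}.
Proof.
by move=> a b; have [g ->] := L2_pi f; rewrite 3!L2_scale_pi piD scalerDl.
Qed.

HB.instance Definition _ := GRing.Zmodule_isLmodule.Build R[i] L2
  L2_scaleA L2_scale1 L2_scaleDr L2_scaleDl.

Definition L2_dot (f g : L2) : R[i] :=
  cintegral mu (fun x => f x * (g x)^*%R).

End square_integrable.

Arguments L2_dot {d T R} mu f g.

(* [K t] is the class of the function [x |-> K(x, t)]. *)
Definition integral_transform d (T : measurableType d) (R : realType)
    (mu : {measure set T -> \bar R}) (X : Type) (K : X -> L2 mu)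
    (f : L2 mu) : X -> R[i] :=
  fun t => cintegral mu (fun x => f x * K t x).

(* Main.v *)
(** Completeness of the orthonormal system [p] and [hr_orth] make [F] injective:
if [F f = 0] then [c k = u k * \int f p_k] is square-summable by Bessel's
inequality, and evaluating [F f] at the nodes [x j] gives
[\sum_k c k * r k (t j) = 0] for all [j].  By [hr_orth] the matrix
[sqrt (rho (t j)) * r k (t j)] has orthonormal columns, so it acts as an
isometry on square-summable sequences and [c = 0]; hence [f = 0].  Everything
else is transported along [F]: [F f s] is the inner product of [f] with the conjugate of
[K s], and [L2 mu] is complete by the Riesz-Fischer theorem. *)
Require Import Defs.
From HB Require Import structures.
From mathcomp Require Import all_boot all_order all_algebra ring_quotient.
From mathcomp Require Import all_classical all_reals all_analysis.
From mathcomp.real_closed Require Import complex.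
From mathcomp Require Import measurable_realfun zify ring lra.
Set Implicit Arguments.
Unset Strict Implicit.
Unset Printing Implicit Defensive.
Import Order.TTheory GRing.Theory Num.Theory.
Import numFieldNormedType.Exports.
Local Open Scope classical_set_scope.
Local Open Scope ring_scope.
Local Open Scope complex_scope.

(** * Modulus and conjugation on [R[i]] *)

Lemma conjE (R : realType) (z : R[i]) :
  (z^*)%R = (complex.Re z -i* complex.Im z).
Proof. by case: z. Qed.

Lemma cnorm_ge0 (R : realType) (z : R[i]) : 0 <= cnorm z.
Proof. by case: z => a b; exact: sqrtr_ge0. Qed.

Lemma normcnorm (R : realType) (z : R[i]) : `|z| = (cnorm z)%:C.
Proof. by rewrite normc_def; case: z. Qed.

Lemma cnormN (R : realType) (z : R[i]) : cnorm (- z) = cnorm z.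
Proof. by case: z => a b; rewrite /cnorm /= !sqrrN. Qed.

(** The reverse triangle inequality for [z] and [- w]; the form with a sum suits the splitting of a
    partial sum into head and tail. *)
Lemma ler_dist_cnormD (R : realType) (z w : R[i]) :
  `|cnorm z - cnorm w| <= cnorm (z + w).
Proof.
have tri (a b : R[i]) : cnorm a <= cnorm (a + b) + cnorm b.
  rewrite -lecR rmorphD /= -!normcnorm -{1}[a](addrK b) -(normrN b).
  exact: ler_normD.
have := tri w z; have := tri z w; rewrite [w + z]addrC => zw wz.
by rewrite ler_norml; apply/andP; split; lra.
Qed.

Lemma cnormM (R : realType) (z w : R[i]) : cnorm (z * w) = cnorm z * cnorm w.
Proof. exact: ComplexField.Normc.normcM. Qed.

Lemma cnorm_eq0 (R : realType) (z : R[i]) : cnorm z = 0 -> z = 0.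
Proof. exact: ComplexField.Normc.eq0_normc. Qed.

Lemma cnorm_real (R : realType) (c : R) : cnorm c%:C = `|c|.
Proof. by rewrite /cnorm /= expr0n /= addr0 sqrtr_sqr. Qed.

Lemma cnorm_conj (R : realType) (z : R[i]) : cnorm (z^*)%R = cnorm z.
Proof. by case: z => a b; rewrite /cnorm /= sqrrN. Qed.

Lemma mulcJ (R : realType) (z : R[i]) : z * (z^*)%R = (cnorm z ^+ 2)%:C.
Proof.
rewrite conjE cnorm2E; case: z => a b; apply/eqP; rewrite eq_complex /=.
by apply/andP; split; apply/eqP; ring.
Qed.

Lemma normr_Re_le_cnorm (R : realType) (z : R[i]) : `|complex.Re z| <= cnorm z.
Proof.
case: z => a b; rewrite -sqrtr_sqr ler_wsqrtr//=.
by rewrite lerDl sqr_ge0.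
Qed.

Lemma normr_Im_le_cnorm (R : realType) (z : R[i]) : `|complex.Im z| <= cnorm z.
Proof.
case: z => a b; rewrite -sqrtr_sqr ler_wsqrtr//=.
by rewrite lerDr sqr_ge0.
Qed.

Lemma ReB (R : realType) (z w : R[i]) :
  complex.Re (z - w) = complex.Re z - complex.Re w.
Proof. by case: z w => ? ? []. Qed.

Lemma ImB (R : realType) (z w : R[i]) :
  complex.Im (z - w) = complex.Im z - complex.Im w.
Proof. by case: z w => ? ? []. Qed.

(** Twice the gap is a sum of squares. The bound serves to dominate both components of a complex
    product by the sum of the squared moduli. *)
Lemma ler_norm_mulD (R : realFieldType) (a b c d : R) :
  `|a * c + b * d| <= a ^+ 2 + b ^+ 2 + (c ^+ 2 + d ^+ 2).
Proof.
rewrite ler_norml; apply/andP; split; rewrite -subr_ge0.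
  rewrite (_ : _ - _ =
    ((a + c) ^+ 2 + (b + d) ^+ 2 + (a ^+ 2 + b ^+ 2 + (c ^+ 2 + d ^+ 2))) / 2).
    by rewrite divr_ge0// !addr_ge0// sqr_ge0.
  by field.
rewrite (_ : _ - _ =
  ((a - c) ^+ 2 + (b - d) ^+ 2 + (a ^+ 2 + b ^+ 2 + (c ^+ 2 + d ^+ 2))) / 2).
  by rewrite divr_ge0// !addr_ge0// sqr_ge0.
by field.
Qed.

(** * Complex integrals by real and imaginary parts *)

Section cintegral.
Context d (T : measurableType d) (R : realType).
Variable mu : {measure set T -> \bar R}.
Implicit Types f g : T -> R[i].

Definition cmeasurable f :=
  measurable_fun setT (fun x => complex.Re (f x)) /\
  measurable_fun setT (fun x => complex.Im (f x)).

Definition cintegrable f :=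
  mu.-integrable setT (EFin \o (fun x => complex.Re (f x))) /\
  mu.-integrable setT (EFin \o (fun x => complex.Im (f x))).

Lemma cmeasurable_conj f : cmeasurable f -> cmeasurable (fun x => ((f x)^*)%R).
Proof.
move=> [fr fi]; split.
  rewrite (_ : (fun x => _) = (fun x => complex.Re (f x)))//.
  by apply/funext => x; rewrite conjE.
under eq_fun do rewrite conjE /=.
exact: measurableT_comp.
Qed.

Lemma cmeasurableM f g : cmeasurable f -> cmeasurable g ->
  cmeasurable (fun x => f x * g x).
Proof.
move=> [fr fi] [gr gi]; split.
  under eq_fun do rewrite Defs.ReM.
  by apply: measurable_funB; apply: measurable_funM.
under eq_fun do rewrite Defs.ImM.
by apply: measurable_funD; apply: measurable_funM.
Qed.

Lemma cmeasurableDZ a f g : cmeasurable f -> cmeasurable g ->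
  cmeasurable (fun x => a * f x + g x).
Proof.
move=> fm [gr gi]; have [fr fi] : cmeasurable (fun x => a * f x).
  by apply: cmeasurableM => //; split; exact: measurable_cst.
split; first by under eq_fun do rewrite Defs.ReD; apply: measurable_funD.
by under eq_fun do rewrite Defs.ImD; apply: measurable_funD.
Qed.

Lemma measurable_cnorm2B f g : cmeasurable f -> cmeasurable g ->
  measurable_fun setT (fun x => (cnorm (f x - g x) ^+ 2)%:E).
Proof.
move=> fm gm; have [mr mi] := cmeasurableDZ (-1) gm fm.
have := measurable_cnorm2 mr mi; congr (measurable_fun _ _).
by apply/funext => x /=; rewrite mulN1r addrC.
Qed.

(** Operations on classes in [L2 mu] act on representatives only up to null sets, so identities
    between integrals of classes go through this lemma. *)
Lemma eq_ae_cintegral f g : cmeasurable f -> cmeasurable g ->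
  {ae mu, forall x, f x = g x} -> cintegral mu f = cintegral mu g.
Proof.
move=> [fr fi] [gr gi] fg; rewrite /cintegral /Rintegral.
congr (fine _ +i* fine _); apply: ae_eq_integral => //;
  (try exact/measurable_EFinP); by apply: filterS fg => x -> _.
Qed.

Lemma cintegralDZ a f g : cintegrable f -> cintegrable g ->
  cintegral mu (fun x => a * f x + g x) = a * cintegral mu f + cintegral mu g.
Proof.
move=> [fr fi] [gr gi].
have Z (c : R) h : mu.-integrable setT (EFin \o h) ->
    mu.-integrable setT (EFin \o (fun x => c * h x)).
  by move=> ih; exact: (integrableZl measurableT c ih).
rewrite /cintegral; apply/eqP; rewrite eq_complex.
apply/andP; split; apply/eqP => /=.
  rewrite Defs.ReD Defs.ReM /=.
  under eq_Rintegral => x _ do rewrite Defs.ReD Defs.ReM.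
  rewrite RintegralD//; last first.
    exact: (integrableB measurableT (Z _ _ fr) (Z _ _ fi)).
  rewrite RintegralB//; [|exact: Z..].
  by rewrite !RintegralZl.
rewrite Defs.ImD Defs.ImM /=.
under eq_Rintegral => x _ do rewrite Defs.ImD Defs.ImM.
rewrite RintegralD//; last first.
  exact: (integrableD measurableT (Z _ _ fi) (Z _ _ fr)).
rewrite RintegralD//; [|exact: Z..].
by rewrite !RintegralZl.
Qed.

Lemma cintegral_conj f : cintegrable f ->
  cintegral mu (fun x => ((f x)^*)%R) = (cintegral mu f)^*%R.
Proof.
move=> [fr fi]; rewrite [RHS]conjE /cintegral /=; congr (_ +i* _).
  by apply: eq_Rintegral => x _; rewrite conjE.
under eq_Rintegral => x _ do rewrite conjE /= -mulN1r.
by rewrite RintegralZl// mulN1r.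
Qed.

Lemma sqint_cmeasurable f : sqint_set mu f -> cmeasurable f.
Proof. by case. Qed.

Lemma sqint_integrable_cnorm2 f : sqint_set mu f ->
  mu.-integrable setT (EFin \o (fun x => cnorm (f x) ^+ 2)).
Proof.
move=> [fr fi fI]; apply/integrableP; split; first exact: measurable_cnorm2.
by under eq_integral => x _ do rewrite /= ger0_norm ?sqr_ge0//.
Qed.

(** Both components of the product are dominated by [|f|^2 + |g|^2]. *)
Lemma sqint_cintegrable f g : sqint_set mu f -> sqint_set mu g ->
  cintegrable (fun x => f x * g x).
Proof.
move=> fs gs.
have [mr mi] : cmeasurable (fun x => f x * g x).
  by apply: cmeasurableM; exact: sqint_cmeasurable.
have I := integrableD measurableT
  (sqint_integrable_cnorm2 fs) (sqint_integrable_cnorm2 gs).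
split; apply: le_integrable I => //; try exact/measurable_EFinP;
  move=> x _ /=; rewrite lee_fin [leRHS]ger0_norm ?addr_ge0 ?sqr_ge0//.
- rewrite Defs.ReM !cnorm2E -mulrN.
  by rewrite (le_trans (ler_norm_mulD _ _ _ _))// sqrrN.
- rewrite Defs.ImM !cnorm2E (le_trans (ler_norm_mulD _ _ _ _))//.
  by rewrite [X in _ + X <= _]addrC.
Qed.

Lemma sqint_conj f : sqint_set mu f -> sqint_set mu (fun x => ((f x)^*)%R).
Proof.
move=> fs; have [mr mi] := cmeasurable_conj (sqint_cmeasurable fs); split => //.
by under eq_integral => x _ do rewrite cnorm_conj; case: fs.
Qed.

End cintegral.

(** * The inner product and conjugation on [L2 mu] *)

Section L2_theory.
Context d (T : measurableType d) (R : realType).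
Variable mu : {measure set T -> \bar R}.
Local Open Scope quotient_scope.
Implicit Types f g h : L2 mu.

Lemma L2_sqint f : sqint_set mu f.
Proof. by have := sqint_valP (repr f); rewrite inE. Qed.

Lemma L2_cmeasurable f : cmeasurable f.
Proof. exact: sqint_cmeasurable (L2_sqint f). Qed.

Lemma L2_eqP f g : f = g <-> {ae mu, forall x, f x = g x}.
Proof. by rewrite -[X in X = _]reprK -[X in _ = X]reprK; exact: L2_ae_eqP. Qed.

Lemma L2_pi_ae (h : sqint_fun mu) :
  {ae mu, forall x, (\pi_(L2 mu) h : L2 mu) x = h x}.
Proof. by apply/L2_ae_eqP; rewrite reprK. Qed.

Lemma sqint_L2 (h : T -> R[i]) : sqint_set mu h ->
  exists f, {ae mu, forall x, f x = h x}.
Proof.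
move=> hs; have hs' : h \in sqint mu by rewrite inE.
by exists (\pi_(L2 mu) (SqintFun hs')); exact: L2_pi_ae.
Qed.

(** The choice of representatives need not be linear; both sides represent the same class, hence
    agree almost everywhere. *)
Lemma L2_DZ_ae a f g :
  {ae mu, forall x, (a *: f + g : L2 mu) x = a * f x + g x}.
Proof.
have -> : a *: f + g = \pi_(L2 mu) (a *: repr f + repr g).
  rewrite -[f in LHS]reprK -[g in LHS]reprK -[_ *: _]/(L2_scale _ _).
  rewrite L2_scale_pi; exact: esym (Quotient.pi_add _ _ _).
exact: L2_pi_ae.
Qed.

Lemma L2_B_ae f g : {ae mu, forall x, (f - g : L2 mu) x = f x - g x}.
Proof.
rewrite addrC -scaleN1r; apply: filterS (L2_DZ_ae (-1) g f) => x ->.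
by rewrite mulN1r addrC.
Qed.

Lemma L2_cintegrable_mul f g : cintegrable mu (fun x => f x * (g x)^*%R).
Proof. by apply: sqint_cintegrable; [|apply: sqint_conj]; exact: L2_sqint. Qed.

Lemma L2_mul_cmeasurable f g : cmeasurable (fun x => f x * (g x)^*%R).
Proof.
by apply: cmeasurableM; [|apply: cmeasurable_conj]; exact: L2_cmeasurable.
Qed.

Lemma L2_dotDZl a f g h :
  L2_dot mu (a *: f + g) h = a * L2_dot mu f h + L2_dot mu g h.
Proof.
rewrite /L2_dot -cintegralDZ; [|exact: L2_cintegrable_mul..].
apply: eq_ae_cintegral; [exact: L2_mul_cmeasurable| |].
  by apply: cmeasurableDZ; exact: L2_mul_cmeasurable.
by apply: filterS (L2_DZ_ae a f g) => x ->; rewrite mulrDl mulrA.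
Qed.

Lemma L2_dotC f g : L2_dot mu g f = (L2_dot mu f g)^*%R.
Proof.
rewrite /L2_dot -cintegral_conj; last exact: L2_cintegrable_mul.
by congr cintegral; apply/funext => x; rewrite rmorphM/= conjCK mulrC.
Qed.

Lemma L2_dotff f : L2_dot mu f f = (\int[mu]_x (cnorm (f x) ^+ 2))%R%:C.
Proof.
rewrite /L2_dot /cintegral; apply/eqP; rewrite eq_complex.
apply/andP; split; apply/eqP => /=.
  by apply: eq_Rintegral => x _; rewrite conjE Defs.ReM cnorm2E /= mulrN opprK.
under eq_Rintegral => x _ do
  rewrite conjE Defs.ImM /= mulrN [_ * complex.Re _]mulrC addNr.
by rewrite Rintegral_cst// mul0r.
Qed.

(** The extended-real form of the squared norm, to which Fatou's lemma applies; [fine] loses nothing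
    because the integral is finite. *)
Lemma L2_hnorm2 f :
  (hnorm (L2_dot mu) f ^+ 2)%:E = (\int[mu]_x (cnorm (f x) ^+ 2)%:E)%E.
Proof.
rewrite /hnorm sqr_sqrtr L2_dotff/=; last first.
  by apply: Rintegral_ge0 => x _; exact: sqr_ge0.
rewrite /Rintegral fineK// ge0_fin_numE; first by case: (L2_sqint f).
by apply: integral_ge0 => x _; rewrite lee_fin sqr_ge0.
Qed.

Lemma L2_dot_ge0 f : 0 <= L2_dot mu f f.
Proof.
by rewrite L2_dotff ler0c; apply: Rintegral_ge0 => x _; exact: sqr_ge0.
Qed.

Lemma L2_dot_eq0 f : L2_dot mu f f = 0 -> f = 0.
Proof.
move=> f0; have : (\int[mu]_x `|(cnorm (f x) ^+ 2)%:E|)%E = 0.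
  rewrite -[RHS]/(0%R%:E).
  have -> : 0 = hnorm (L2_dot mu) f ^+ 2 by rewrite /hnorm f0/= sqrtr0 expr0n.
  rewrite L2_hnorm2; apply: eq_integral => x _.
  by rewrite gee0_abs// lee_fin sqr_ge0.
move/ae_eq_integral_abs => /(_ measurableT); have [fr fi _] := L2_sqint f.
move=> /(_ (measurable_cnorm2 fr fi)) f0'.
rewrite -(subrr f); apply/L2_eqP.
apply: filterS2 f0' (L2_B_ae f f) => x /(_ I) /= [fx0] ->.
by rewrite subrr; apply: cnorm_eq0; apply/eqP; rewrite -sqrf_eq0 fx0.
Qed.

(** The default [0] of [xget] is never reached, as the conjugate of a square-integrable function is
    square-integrable. Conjugation turns the pairing [\int f g] of the transform into an inner
    product. *)
Definition L2_conj f : L2 mu :=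
  xget (0 : L2 mu) [set g : L2 mu | {ae mu, forall x, g x = (f x)^*%R}].

Lemma L2_conj_ae f : {ae mu, forall x, L2_conj f x = (f x)^*%R}.
Proof.
have [g hg] := sqint_L2 (sqint_conj (L2_sqint f)).
exact: (@xgetI _ _ [set g : L2 mu | {ae mu, forall x, g x = (f x)^*%R}] g).
Qed.

Lemma L2_conjK f : L2_conj (L2_conj f) = f.
Proof.
apply/L2_eqP.
apply: filterS2 (L2_conj_ae f) (L2_conj_ae (L2_conj f)) => x fx ->.
by rewrite fx conjCK.
Qed.

Lemma L2_dot_conjr f g :
  L2_dot mu f (L2_conj g) = cintegral mu (fun x => f x * g x).
Proof.
apply: eq_ae_cintegral; first exact: L2_mul_cmeasurable.
  by apply: cmeasurableM; exact: L2_cmeasurable.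
by apply: filterS (L2_conj_ae g) => x ->; rewrite conjCK.
Qed.

(** Both sides equal the symmetric pairing [\int f g]. *)
Lemma L2_dot_conjr_swap f g : L2_dot mu f (L2_conj g) = L2_dot mu g (L2_conj f).
Proof.
by rewrite !L2_dot_conjr; congr cintegral; apply/funext => x; rewrite mulrC.
Qed.

End L2_theory.

(** * Completeness of [L2 mu] (Riesz-Fischer) *)

Lemma cvg_geometric_increments (R : realType) (a : nat -> R) (C : R) :
  (forall k, `|a k.+1 - a k| <= C * 2^-1 ^+ k) -> cvgn a.
Proof.
move=> aC.
have C0 : 0 <= C.
  by have := le_trans (normr_ge0 _) (aC 0%N); rewrite expr0 mulr1.
(* The series of increments converges absolutely by comparison with a geometric series; its partial
   sums are [a n - a 0]. *)
have : cvgn (series (telescope a)).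
  apply: normed_cvg; apply: (@series_le_cvg _ _ (geometric C 2^-1)).
  - by move=> n; exact: normr_ge0.
  - by move=> n; rewrite /geometric /= mulr_ge0// exprn_ge0.
  - exact: aC.
  - apply: is_cvg_geometric_series.
    by rewrite ger0_norm// invf_lt1// ltr1n.
rewrite (_ : series _ = a - cst (a 0%N)); last first.
  by apply/funext => n; rewrite telescopeK.
move=> /is_cvgD => /(_ (cst (a 0%N)) (is_cvg_cst _)).
by rewrite subrK.
Qed.

Lemma limn_einf_le (R : realType) (v : nat -> \bar R) (c : \bar R) (N : nat) :
  (forall n, (N <= n)%N -> (v n <= c)%E) -> (limn_einf v <= c)%E.
Proof.
move=> vc; rewrite limn_einf_lim; apply: lime_le; first exact: is_cvg_einfs.
apply: nearW => n; apply: (@le_trans _ _ (v (maxn N n))); last first.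
  by apply: vc; rewrite leq_maxl.
by apply: ereal_inf_lbound; exists (maxn N n) => //=; exact: leq_maxr.
Qed.

Section riesz_fischer.
Context d (T : measurableType d) (R : realType).
Variable mu : {measure set T -> \bar R}.

Lemma L2_hnormB2 (f g : L2 mu) :
  (hnorm (L2_dot mu) (f - g) ^+ 2)%:E =
  (\int[mu]_x (cnorm (f x - g x) ^+ 2)%:E)%E.
Proof.
rewrite L2_hnorm2; apply: ae_eq_integral => //.
- by case: (L2_sqint (f - g)) => mr mi _; exact: measurable_cnorm2.
- by apply: measurable_cnorm2B; exact: L2_cmeasurable.
- by apply: filterS (L2_B_ae f g) => x -> _.
Qed.

Lemma L2_hcauchy_subseq (u : nat -> L2 mu) : hcauchy (L2_dot mu) u ->
  exists phi : nat -> nat, (forall k, (k <= phi k)%N) /\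
    forall k, hnorm (L2_dot mu) (u (phi k.+1) - u (phi k)) <
      2^-1 ^+ k * 2^-1 ^+ k.
Proof.
move=> cu.
have /choice [N hN] : forall k, exists N, forall m n,
    (N <= m)%N -> (N <= n)%N ->
    hnorm (L2_dot mu) (u m - u n) < 2^-1 ^+ k * 2^-1 ^+ k.
  by move=> k; apply: cu; rewrite mulr_gt0// exprn_gt0.
(* Adding the thresholds up to [k] puts [phi k] and [phi k.+1] past [N k]; the extra summand [k]
   gives [k <= phi k]. *)
exists (fun k => (k + \sum_(i < k.+1) N i)%N).
split=> [k|k]; first exact: leq_addr.
apply: hN; first by rewrite 2!big_ord_recr/=; lia.
by rewrite big_ord_recr/=; lia.
Qed.

(* If [hnorm (v k.+1 - v k) < 4^-k], then [\sum_k 4^k |v k.+1 - v k|^2] is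
   integrable, hence almost everywhere finite, and where it is finite the
   increments of [v] are [O(2^-k)]. *)
Lemma L2_fast_ae (v : nat -> L2 mu) :
  (forall k, hnorm (L2_dot mu) (v k.+1 - v k) < 2^-1 ^+ k * 2^-1 ^+ k) ->
  {ae mu, forall x, exists C : R, forall k,
    cnorm (v k.+1 x - v k x) <= C * 2^-1 ^+ k}.
Proof.
move=> vfast.
pose h k x : \bar R := ((cnorm (v k.+1 x - v k x) / 2^-1 ^+ k) ^+ 2)%:E.
have q0 k : 0 < 2^-1 ^+ k :> R by rewrite exprn_gt0.
have h0 k x : (0 <= h k x)%E by rewrite lee_fin sqr_ge0.
have mB k : measurable_fun setT (fun x => (cnorm (v k.+1 x - v k x) ^+ 2)%:E).
  by apply: measurable_cnorm2B; exact: L2_cmeasurable.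
have hE k x : h k x =
    (((2^-1 ^+ k) ^- 2)%:E * (cnorm (v k.+1 x - v k x) ^+ 2)%:E)%E.
  by rewrite -EFinM /h expr_div_n mulrC.
have mh k : measurable_fun setT (h k).
  by rewrite (funext (hE k)); apply: measurable_funeM; exact: mB.
(* The integral is at most [4^k * 16^-k = 4^-k]; the weaker bound [2^-k] is already summable. *)
have Ih k : (\int[mu]_x h k x <= (2^-1 ^+ k)%:E)%E.
  under eq_integral do rewrite hE.
  rewrite ge0_integralZl_EFin//; first last.
  - by move=> x _; rewrite lee_fin sqr_ge0.
  - rewrite -L2_hnormB2 -EFinM lee_fin ler_pdivrMl ?exprn_gt0//.
    have := vfast k; set H := hnorm _ _ => Hk.
    have H0 : 0 <= H by exact: sqrtr_ge0.
    apply: (@le_trans _ _ ((2^-1 ^+ k * 2^-1 ^+ k) ^+ 2)).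
      by rewrite ler_pXn2r// ?nnegrE ?mulr_ge0 ?(ltW (q0 _))// ltW.
    rewrite exprMn ler_pM2l ?exprn_gt0// expr2 ger_pMl//.
    by rewrite exprn_ile1// invf_le1// ler1n.
have mG : measurable_fun setT (fun x => \sum_(k <oo) h k x)%E.
  exact: ge0_emeasurable_sum.
have IG : mu.-integrable setT (fun x => \sum_(k <oo) h k x)%E.
  apply/integrableP; split => //.
  under eq_integral => x _ do rewrite gee0_abs ?nneseries_ge0//.
  rewrite integral_nneseries//.
  apply: (@le_lt_trans _ _ (\sum_(k <oo) (2^-1 ^+ k)%:E)%E).
    by apply: lee_nneseries => [k _ _|k _]; [apply: integral_ge0|exact: Ih].
  (* This series has terms [2 / 2^(k+1) = 2^-k] and sum [2]. *)
  have := @cvg_geometric_eseries_half R 2 0; rewrite expr0 divr1.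
  move/cvg_lim => /(_ (@ereal_hausdorff _)) => E.
  rewrite (_ : (\sum_(k <oo) _)%E = 2%:E) ?ltry// -E.
  apply: congr_lim; apply/funext => n; rewrite /eseries/=.
  apply: eq_bigr => k _; congr EFin.
  by rewrite addn1 expnS natrM natrX exprVn invfM mulrA divff// mul1r.
have := integrable_ae measurableT IG.
apply: filterS => x /(_ I) Gx.
(* One term of a nonnegative series is at most its sum, so the root of the sum serves for every
   [k]. *)
exists (Num.sqrt (fine (\sum_(k <oo) h k x)%E)) => k.
rewrite -ler_pdivrMr// -[leLHS]ger0_norm; last first.
  by apply: divr_ge0; [exact: cnorm_ge0|exact: ltW].
rewrite -sqrtr_sqr ler_wsqrtr// -lee_fin fineK//.
apply: le_trans (nneseries_lim_ge k.+1 _); last by [].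
by rewrite big_nat_recr//= leeDr// sume_ge0.
Qed.

(** A fast subsequence converges almost everywhere. Fatou's lemma bounds the distance from its
    pointwise limit to [u n] by the Cauchy bound, so the whole sequence converges to that limit. *)
Lemma L2_complete (u : nat -> L2 mu) : hcauchy (L2_dot mu) u ->
  exists2 l, setT l & hcvg (L2_dot mu) u l.
Proof.
move=> cu; have [phi [phik phifast]] := L2_hcauchy_subseq cu.
pose v k := u (phi k).
have [A [mA A0 Av]] := L2_fast_ae phifast.
(* Zeroing [v k] on the null set [A] makes the limits exist at every point, so [limn] below denotes
   a genuine limit and [l] is measurable. *)
pose w k x : R[i] := (\1_(~`A) x)%:C * v k x.
have wE k x : ~ A x -> w k x = v k x.
  by move=> Ax; rewrite /w indicE mem_set// mul1r.
have wA k x : A x -> w k x = 0.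
  by move=> Ax; rewrite /w indicE memNset ?mul0r//; exact.
have wC x : exists C, forall k, cnorm (w k.+1 x - w k x) <= C * 2^-1 ^+ k.
  have [Ax|Ax] := pselect (A x).
    exists 0 => k; rewrite !wA// subr0 mul0r.
    by rewrite cnorm_real normr0.
  have : (exists C : R, forall k, cnorm (v k.+1 x - v k x) <= C * 2^-1 ^+ k).
    by apply: contrapT => nC; apply: Ax; exact: Av.
  by move=> [C hC]; exists C => k; rewrite !wE.
have cr x : cvgn (fun k => complex.Re (w k x)).
  have [C hC] := wC x; apply: (@cvg_geometric_increments _ _ C) => k.
  by rewrite -ReB (le_trans (normr_Re_le_cnorm _)).
have ci x : cvgn (fun k => complex.Im (w k x)).
  have [C hC] := wC x; apply: (@cvg_geometric_increments _ _ C) => k.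
  by rewrite -ImB (le_trans (normr_Im_le_cnorm _)).
have mw k : cmeasurable (w k).
  apply: cmeasurableM; last exact: L2_cmeasurable.
  by split => //=; exact/measurable_indic/measurableC.
pose l x :=
  limn (fun k => complex.Re (w k x)) +i* limn (fun k => complex.Im (w k x)).
have [mlr mli] : cmeasurable l.
  split.
    apply: (@measurable_fun_cvg _ _ _ _ (fun k x => complex.Re (w k x)))
      => // k; by case: (mw k).
  apply: (@measurable_fun_cvg _ _ _ _ (fun k x => complex.Im (w k x))) => // k.
  by case: (mw k).
have mwB k n : measurable_fun setT (fun x => (cnorm (w k x - u n x) ^+ 2)%:E).
  by apply: measurable_cnorm2B => //; exact: L2_cmeasurable.
(* Fatou's lemma in [k] with [n] fixed; since [k <= phi k], the assumption covers [u (phi k)] as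
   soon as [M <= k]. *)
have lB n e M : (forall m, (M <= m)%N -> hnorm (L2_dot mu) (u m - u n) <= e) ->
    (\int[mu]_x (cnorm (l x - u n x) ^+ 2)%:E <= (e ^+ 2)%:E)%E.
  move=> ue.
  have -> : (\int[mu]_x (cnorm (l x - u n x) ^+ 2)%:E =
      \int[mu]_x limn_einf (fun k => (cnorm (w k x - u n x) ^+ 2)%:E))%E.
    apply: eq_integral => x _; apply/esym.
    have c : (fun k => (cnorm (w k x - u n x) ^+ 2)%:E) @ \oo -->
        (cnorm (l x - u n x) ^+ 2)%:E.
      apply: cvg_EFin; first exact: nearW.
      rewrite /comp/= cnorm2E ReB ImB.
      under eq_fun do rewrite cnorm2E ReB ImB.
      by apply: cvgD; rewrite expr2; under eq_fun do rewrite expr2;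
        apply: cvgM; apply: cvgB; (try exact: cvg_cst);
        [exact: cr|exact: cr|exact: ci|exact: ci].
    rewrite is_cvg_limn_einfE; first exact/cvg_lim.
    by apply/cvg_ex; eexists; exact: c.
  apply: (le_trans (fatou _ measurableT _ _)) => //.
    by move=> k x _; rewrite lee_fin sqr_ge0.
  apply: (limn_einf_le (N := M)) => k Mk.
  have -> : (\int[mu]_x (cnorm (w k x - u n x) ^+ 2)%:E =
             (hnorm (L2_dot mu) (v k - u n) ^+ 2)%:E)%E.
    rewrite L2_hnormB2; apply: ae_eq_integral => //.
      by apply: measurable_cnorm2B; exact: L2_cmeasurable.
    exists A; split => // x /= wv; apply: contrapT => Ax; apply: wv => _.
    by rewrite wE.
  have H0 : 0 <= hnorm (L2_dot mu) (v k - u n) by exact: sqrtr_ge0.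
  have He : hnorm (L2_dot mu) (v k - u n) <= e.
    by apply: ue; exact: leq_trans (phik k).
  by rewrite lee_fin ler_pXn2r// nnegrE (le_trans H0).
(* Square-integrability of [l] is still open: the bound with [e = 1] gives it for [l - u N1], and
   [u N1] is then added back. *)
have [N1 hN1] := cu 1 ltr01.
have lB1 : sqint_set mu (fun x => l x - u N1 x).
  split.
  - under eq_fun do rewrite ReB.
    by apply: measurable_funB => //; case: (L2_cmeasurable (u N1)).
  - under eq_fun do rewrite ImB.
    by apply: measurable_funB => //; case: (L2_cmeasurable (u N1)).
  - apply: (le_lt_trans (lB N1 1 N1 _)); last exact: ltry.
    by move=> m hm; apply/ltW/hN1.
have ls : sqint_set mu l.
  have [_ /(_ 1 (fun x => l x - u N1 x) (u N1))] := sqint_submod_closed mu.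
  rewrite !inE => /(_ lB1 (L2_sqint _)); congr sqint_set.
  by apply/funext => x; rewrite scale1r; exact: subrK.
have [L hL] := sqint_L2 ls.
exists L => //; apply/cvgrPdist_le => e e0.
have [M hM] := cu e e0.
exists M => // n /= Mn; rewrite sub0r normrN ger0_norm; last exact: sqrtr_ge0.
have H0 : 0 <= hnorm (L2_dot mu) (u n - L) by exact: sqrtr_ge0.
rewrite -(@ler_pXn2r _ 2)// ?nnegrE//; last exact: ltW.
rewrite -lee_fin L2_hnormB2.
apply: le_trans (lB n e M _); last by move=> m Mm; apply/ltW/hM.
rewrite le_eqVlt; apply/orP; left; apply/eqP; apply: ae_eq_integral => //.
- by apply: measurable_cnorm2B; exact: L2_cmeasurable.
- by apply: measurable_cnorm2B => //; exact: L2_cmeasurable.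
- by apply: filterS hL => x -> _; rewrite !cnorm2E !ReB !ImB; congr EFin; ring.
Qed.

End riesz_fischer.

(** * Inner products: Cauchy-Schwarz, Bessel and completeness of orthonormal systems *)

Section inner_product.
Context {R : realType} {V : lmodType R[i]} {dot : V -> V -> R[i]}.
Hypothesis hV : is_hilbert setT dot.

Let dotDZl a f g h : dot (a *: f + g) h = a * dot f h + dot g h.
Proof. by case: hV => _ H _ _ _; exact: H. Qed.

Let dotC f g : dot g f = (dot f g)^*%R.
Proof. by case: hV => _ _ H _ _; exact: H. Qed.

Let dot_ge0 f : 0 <= dot f f.
Proof. by case: hV => _ _ _ H _; case: (H f). Qed.

Let dot_eq0 f : dot f f = 0 -> f = 0.
Proof. by case: hV => _ _ _ H _; case: (H f I). Qed.

Lemma dot0l h : dot 0 h = 0.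
Proof.
have := dotDZl 1 0 0 h; rewrite scaler0 addr0 mul1r => /eqP.
by rewrite -subr_eq subrr => /eqP ->.
Qed.

Lemma dotDl f g h : dot (f + g) h = dot f h + dot g h.
Proof. by have := dotDZl 1 f g h; rewrite scale1r mul1r. Qed.

Lemma dotZl a f h : dot (a *: f) h = a * dot f h.
Proof. by have := dotDZl a f 0 h; rewrite dot0l !addr0. Qed.

Lemma dotBl f g h : dot (f - g) h = dot f h - dot g h.
Proof. by rewrite dotDl -scaleN1r dotZl mulN1r. Qed.

Lemma dot_suml n (F : 'I_n -> V) h : dot (\sum_k F k) h = \sum_k dot (F k) h.
Proof. by apply: (big_morph (dot^~ h) (fun f g => dotDl f g h) (dot0l h)). Qed.

Lemma dotZr a f h : dot h (a *: f) = (a^*)%R * dot h f.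
Proof. by rewrite dotC dotZl rmorphM /= -dotC. Qed.

Lemma dotBr f g h : dot h (f - g) = dot h f - dot h g.
Proof. by rewrite dotC dotBl rmorphB /= -!dotC. Qed.

Lemma dot_sumr n (F : 'I_n -> V) h : dot h (\sum_k F k) = \sum_k dot h (F k).
Proof.
by rewrite dotC dot_suml rmorph_sum /=; apply: eq_bigr => k _; rewrite -dotC.
Qed.

Lemma hnorm_ge0 f : 0 <= hnorm dot f.
Proof. exact: sqrtr_ge0. Qed.

Lemma dotff f : dot f f = (hnorm dot f ^+ 2)%:C.
Proof.
have := dot_ge0 f; rewrite /hnorm; case: (dot f f) => a b.
by rewrite lecE /= => /andP[/eqP -> a0]; rewrite sqr_sqrtr.
Qed.

Lemma hnorm_eq0 f : hnorm dot f = 0 -> f = 0.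
Proof. by move=> f0; apply: dot_eq0; rewrite dotff f0 expr0n. Qed.

(** Expand the squared norm of [<g,g> f - <f,g> g] and cancel the factor [<g,g>]. This cancellation
    needs [g] nonzero, whence the case split. *)
Lemma cauchy_schwarz f g : cnorm (dot f g) <= hnorm dot f * hnorm dot g.
Proof.
have [g0|g0] := eqVneq (hnorm dot g) 0.
  by rewrite g0 (hnorm_eq0 g0) dotC dot0l rmorph0 mulr0 cnorm_real normr0.
have gp : 0 < hnorm dot g by rewrite lt_def g0 hnorm_ge0.
rewrite -(@ler_pXn2r _ 2)// ?nnegrE ?cnorm_ge0 ?mulr_ge0 ?hnorm_ge0//.
have := dot_ge0 (dot g g *: f - dot f g *: g).
rewrite dotBl !dotBr !dotZl !dotZr -(dotC g g) [dot g f]dotC.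
set a := dot f g.
rewrite (_ : _ - _ = dot g g * (dot g g * dot f f - a * (a^*)%R)); last first.
  by rewrite /a; ring.
rewrite !dotff mulcJ -rmorphM -rmorphB -rmorphM ler0c pmulr_rge0 ?exprn_gt0//.
by rewrite subr_ge0 exprMn mulrC.
Qed.

Lemma hnormDsq_ortho f g : dot f g = 0 ->
  hnorm dot (f - g) ^+ 2 = hnorm dot f ^+ 2 + hnorm dot g ^+ 2.
Proof.
move=> fg; apply: (@complexI R); rewrite rmorphD /= -!dotff dotBl !dotBr.
rewrite fg [dot g f]dotC fg.
by rewrite rmorph0 subr0 sub0r opprK.
Qed.

Section orthonormal.
Variable p : nat -> V.
Hypothesis p_orth : orthonormal_system setT dot p.

(** With [s] the projection of [g] on the span of the first [n] vectors, [<g,s> = <s,s>], so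
    [<g-s,g-s> = <g,g> - <s,s>]. *)
Lemma bessel g n : \sum_(k < n) cnorm (dot (p k) g) ^+ 2 <= hnorm dot g ^+ 2.
Proof.
have [_ pp] := p_orth.
pose s := \sum_(k < n) dot g (p k) *: p k.
have ss : dot s s = (\sum_(k < n) cnorm (dot (p k) g) ^+ 2)%:C.
  rewrite dot_suml rmorph_sum; apply: eq_bigr => k _ /=.
  rewrite dotZl dot_sumr (bigD1 k)//= big1 ?addr0 => [|i ik].
    by rewrite dotZr pp eqxx mulr1 mulcJ (dotC (p k)) cnorm_conj.
  by rewrite dotZr pp eq_sym (inj_eq val_inj) (negbTE ik) mulr0.
have gs : dot g s = dot s s.
  rewrite ss dot_sumr rmorph_sum; apply: eq_bigr => k _ /=.
  by rewrite dotZr mulrC mulcJ (dotC (p k)) cnorm_conj.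
have := dot_ge0 (g - s).
rewrite dotBl !dotBr gs [dot s g]dotC gs -(dotC s s) subrr subr0 dotff ss.
by rewrite -rmorphB ler0c subr_ge0.
Qed.

(** As [g] is orthogonal to all finite combinations of the [p k], Pythagoras bounds its norm by its
    distance to any of them, which can be made arbitrarily small. *)
Lemma complete_ortho_eq0 g : complete_system setT dot p ->
  (forall k, dot (p k) g = 0) -> g = 0.
Proof.
move=> [_ pc] pg; apply: hnorm_eq0; apply/eqP; rewrite eq_le hnorm_ge0 andbT.
apply/ler_addgt0Pr => e e0; rewrite add0r.
have [n [c /ltW/(le_trans _)]] := pc g I e e0; apply.
rewrite -(@ler_pXn2r _ 2)// ?nnegrE ?hnorm_ge0//.
rewrite hnormDsq_ortho ?lerDl ?sqr_ge0//.
by rewrite dot_sumr big1// => k _; rewrite dotZr dotC pg rmorph0 mulr0.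
Qed.

End orthonormal.
End inner_product.

(** * Transport of a Hilbert structure along an injective linear map *)

Section range_space.
Context {R : realType} {V W : lmodType R[i]} {dot : V -> V -> R[i]}.
Hypothesis hV : is_hilbert setT dot.
Variable U : V -> W.
Hypothesis Ulin : forall a f g, U (a *: f + g) = a *: U f + U g.
Hypothesis Uinj : injective U.

(** Injectivity forces [xget] to return [f] and [g] themselves. *)
Lemma range_dotE f g : range_dot dot U (U f) (U g) = dot f g.
Proof.
rewrite /range_dot; congr dot; apply: Uinj.
  exact: (@xgetI V 0 [set h | U h = U f] f).
exact: (@xgetI V 0 [set h | U h = U g] g).
Qed.

Let U0 : U 0 = 0.
Proof.
have := Ulin 1 0 0; rewrite !scale1r addr0 => /eqP.
by rewrite -subr_eq subrr => /eqP ->.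
Qed.

Let UB f g : U (f - g) = U f - U g.
Proof. by rewrite addrC -scaleN1r Ulin scaleN1r addrC. Qed.

Let hnorm_range f : hnorm (range_dot dot U) (U f) = hnorm dot f.
Proof. by rewrite /hnorm range_dotE. Qed.

(** Each axiom is pulled back to preimages; a Cauchy sequence lifts to a Cauchy sequence because [U]
    preserves norms. *)
Lemma range_hilbert : is_hilbert (range U) (range_dot dot U).
Proof.
have [_ dotDZl dotC dot0 dotcpl] := hV; split.
- split; first by exists 0.
  by move=> a _ _ [f _ <-] [g _ <-]; exists (a *: f + g).
- move=> a _ _ _ [f _ <-] [g _ <-] [h _ <-].
  by rewrite -Ulin !range_dotE dotDZl.
- by move=> _ _ [f _ <-] [g _ <-]; rewrite !range_dotE dotC.
- move=> _ [f _ <-]; rewrite !range_dotE; have [f0 f1] := dot0 f I.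
  by split => // /f1 ->.
- move=> v vU; have /choice [f fE] : forall n, exists f, U f = v n.
    by move=> n; have [f _ <-] := vU n; exists f.
  move=> vc; have fc : hcauchy dot f.
    move=> e /vc [N hN]; exists N => m n Nm Nn.
    by rewrite -hnorm_range UB !fE; exact: hN.
  have [l _ fl] := dotcpl f (fun=> I) fc.
  exists (U l); first by exists l.
  rewrite /hcvg; under eq_fun do rewrite -fE -UB hnorm_range.
  exact: fl.
Qed.

Lemma range_hilbert_iso : hilbert_iso setT dot (range U) (range_dot dot U) U.
Proof.
split => //.
- exact: range_hilbert.
- by split=> [f _|f g _ _ /Uinj|]//; exists f.
- by move=> f g _ _; exact: range_dotE.
Qed.

End range_space.

(** The section of the kernel at [s] is [U (kap s)], so pairing [U f] with it gives [dot f (kap s)],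
    which is the value of [U f] at [s]. *)
Lemma range_reproducing_kernel {R : realType} {V : lmodType R[i]} {X : Type}
    (dot : V -> V -> R[i]) (U : V -> X -> R[i]) (kap : X -> V) :
  injective U -> (forall f s, U f s = dot f (kap s)) ->
  reproducing_kernel (range U) (range_dot dot U)
    (fun t s => dot (kap s) (kap t)).
Proof.
move=> Uinj UE; have kE s : (fun t => dot (kap s) (kap t)) = U (kap s).
  by apply/funext => t; rewrite UE.
split=> [s|_ s [f _ <-]]; first by exists (kap s).
by rewrite kE range_dotE.
Qed.

(** * Infinite matrices with orthonormal columns *)

Lemma cvg_Re (R : realType) (v : nat -> R[i]^o) (l : R[i]^o) :
  v @ \oo --> l -> (fun n => complex.Re (v n)) @ \oo --> complex.Re l.
Proof.
move=> /cvgrPdist_lt vl; apply/cvgrPdist_lt => e e0.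
(* The norm of [R[i]^o] takes values in [R[i]], so the real tolerance is embedded there. *)
have e0' : 0 < e%:C :> R[i] by rewrite ltcR.
have := vl _ e0'; apply: filterS => n; rewrite -ReB normc_def ltcR.
apply: le_lt_trans; rewrite -cnorm2E (le_trans (normr_Re_le_cnorm _))//.
by rewrite sqrtr_sqr ler_norm.
Qed.

Section orthonormal_columns.
Context {R : realType}.
Variables (w : nat -> R) (a : nat -> nat -> R[i]).
Hypothesis w0 : forall j, 0 <= w j.
Hypothesis a_orth : forall n m,
  series (fun j => (w j)%:C * a n j * (a m j)^*%R : R[i]^o) @ \oo -->
    ((m == n)%:R : R[i]^o).

(** Expand the square into a finite double sum over columns; orthonormality leaves only the diagonal
    in the limit. General bounds [N] and [N'] allow tails as well as initial sums. *)
Lemma orthonormal_norm2 (c : nat -> R[i]) (N N' : nat) :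
  series (fun j => w j * cnorm (\sum_(N <= k < N') c k * a k j) ^+ 2) @ \oo -->
    \sum_(N <= k < N') cnorm (c k) ^+ 2.
Proof.
pose S k l : nat -> R[i]^o :=
  series (fun j => (w j)%:C * a k j * (a l j)^*%R : R[i]^o).
have /cvg_Re : (fun M => \sum_(N <= k < N') \sum_(N <= l < N')
     (c k * (c l)^*%R) * S k l M : R[i]^o) @ \oo -->
   (\sum_(N <= k < N') \sum_(N <= l < N')
     (c k * (c l)^*%R) * (l == k)%:R : R[i]^o).
  apply: (cvg_big (op := +%R)) => [|k _]; first exact: add_continuous.
  apply: (cvg_big (op := +%R)) => [|l _]; first exact: add_continuous.
  by apply: cvgM; [exact: cvg_cst|exact: a_orth].
rewrite (_ : \sum_(N <= k < N') \sum_(N <= l < N') _ =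
    (\sum_(N <= k < N') cnorm (c k) ^+ 2)%:C); last first.
  rewrite rmorph_sum; apply: eq_big_nat => k /andP[Nk kN'] /=.
  rewrite (bigD1_seq k) ?mem_index_iota ?Nk ?iota_uniq//= eqxx mulr1.
  rewrite big1 ?addr0.
    exact: mulcJ.
  by move=> l lk; rewrite (negbTE lk) mulr0.
move=> h; apply: cvg_trans h; apply: near_eq_cvg; apply: nearW => M.
(* Already at each finite [M] the double sum is real and equals the weighted partial sum of
   squares. *)
rewrite (_ : \sum_(N <= k < N') \sum_(N <= l < N') _ =
    (series (fun j =>
      w j * cnorm (\sum_(N <= k < N') c k * a k j) ^+ 2) M)%:C)//.
rewrite /S /series/= rmorph_sum/=.
under eq_bigr => k _.
  under eq_bigr => l _ do rewrite mulr_sumr.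
  rewrite exchange_big/=; over.
rewrite exchange_big/=; apply: eq_bigr => j _.
rewrite rmorphM /= -mulcJ rmorph_sum/= big_distrlr /= mulr_sumr.
apply: eq_bigr => k _; rewrite mulr_sumr; apply: eq_bigr => l _.
by rewrite rmorphM /=; ring.
Qed.

(* With [b] the limit of the partial sums [B n], the isometry property applied
   to the tail [N <= k < N'] bounds the first [M] rows of the tail by [b - B N];
   as [N'] grows, these rows tend to those of [- \sum_(k < N)], whose norm in
   the limit [M --> oo] is [B N].  Hence [2 * B N <= b] for all [N]. *)
Lemma orthonormal_ker (c : nat -> R[i]) (C : R) :
  (forall n, \sum_(k < n) cnorm (c k) ^+ 2 <= C) ->
  (forall j, cnorm (\sum_(k < n) c k * a k j) @[n --> \oo] --> (0 : R)) ->
  forall k, c k = 0.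
Proof.
move=> cC ca.
pose B n := \sum_(0 <= k < n) cnorm (c k) ^+ 2.
pose D N N' j := \sum_(N <= k < N') c k * a k j.
pose Q N N' := series (fun j => w j * cnorm (D N N' j) ^+ 2).
have Bnd : nondecreasing_seq B.
  by apply/nondecreasing_seqP => n; rewrite /B big_nat_recr//= lerDl sqr_ge0.
have Bcvg : cvgn B.
  apply: nondecreasing_is_cvgn => //; exists C => _ [n _ <-].
  by rewrite /B big_mkord.
have Bb := nondecreasing_cvgn_le Bnd Bcvg.
set b := limn B in Bb.
have Qtail M N N' : (N <= N')%N -> Q N N' M <= b - B N.
  move=> NN'; have Qcvg := @orthonormal_norm2 c N N'.
  apply: (@le_trans _ _ (\sum_(N <= k < N') cnorm (c k) ^+ 2)); last first.
    by rewrite lerBrDl /B -big_cat_nat//; exact: Bb.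
  rewrite -(cvg_lim (@Rhausdorff R) Qcvg); apply: nondecreasing_cvgn_le.
    apply/nondecreasing_seqP => n; rewrite /Q seriesSr lerDl.
    by rewrite mulr_ge0// sqr_ge0.
  by apply/cvg_ex; eexists; exact: Qcvg.
have Qhead M N : Q 0%N N M <= b - B N.
  have QQ : Q N N' M @[N' --> \oo] --> Q 0%N N M.
    rewrite /Q /series/=; apply: (cvg_big (op := +%R)) => [|j _].
      exact: add_continuous.
    have DD : cnorm (D N N' j) @[N' --> \oo] --> cnorm (D 0%N N j).
      apply/cvgrPdist_le => e e0.
      have /cvgrPdist_le /(_ _ e0) caj := ca j.
      near=> N'.
      (* Head plus tail is the full sum up to [N'], which tends to [0] by [ca]; hence both moduli
         agree in the limit. *)
      apply: (@le_trans _ _ (cnorm (D 0%N N j + D N N' j))).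
        exact: ler_dist_cnormD.
      have NN' : (N <= N')%N by near: N'; exact: nbhs_infty_ge.
      rewrite /D -big_cat_nat// big_mkord.
      rewrite -[leLHS]ger0_norm ?cnorm_ge0// -normrN -sub0r.
      by near: N'.
    by apply: cvgM; [exact: cvg_cst|apply: cvgM].
  apply: (cvgr_to_le QQ); near=> N'; apply: Qtail.
  by near: N'; exact: nbhs_infty_ge.
have B2 N : B N <= b / 2.
  have : B N <= b - B N.
    apply: (cvgr_to_le (@orthonormal_norm2 c 0%N N)); apply: nearW => M.
    exact: Qhead.
  lra.
(* Letting [N] grow in [B N <= b / 2] gives [b <= b / 2]. The nonnegative terms are bounded by [b],
   so all vanish. *)
have b0 : b <= 0.
  have : b <= b / 2 by apply: limr_le => //; exact: nearW.
  lra.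
move=> k; apply: cnorm_eq0; apply/eqP; rewrite -sqrf_eq0.
rewrite eq_le sqr_ge0 andbT (le_trans _ b0)// (le_trans _ (Bb k.+1))//.
by rewrite /B big_nat_recr//= lerDr sumr_ge0// => i _; exact: sqr_ge0.
Unshelve. all: by end_near. Qed.

End orthonormal_columns.

(** * The integral transform on [L2 mu] *)

Lemma L2_is_hilbert d (T : measurableType d) (R : realType)
    (mu : {measure set T -> \bar R}) : is_hilbert setT (L2_dot mu).
Proof.
split => //.
- by move=> a f g h _ _ _; exact: L2_dotDZl.
- by move=> f g _ _; exact: L2_dotC.
- by move=> f _; split; [exact: L2_dot_ge0|exact: L2_dot_eq0].
- by move=> u _; exact: L2_complete.
Qed.

Theorem theorem2 (R : realType)
    (mu : {measure set (measurableTypeR R) -> \bar R})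
    (p : nat -> L2 mu)
    (hp_orth : orthonormal_system setT (L2_dot mu) p)
    (hp_compl : complete_system setT (L2_dot mu) p)
    (t : nat -> R) (ht_inj : injective t) (ht_neq0 : forall j, t j != 0)
    (rho : R -> R) (hrho : forall j, 0 < rho (t j))
    (r : nat -> R -> R[i])
    (hr_orth : forall n m : nat,
      series (fun j => (rho (t j))%:C * r n (t j) * (r m (t j))^*%R : R[i]^o)
        @ \oo --> ((m == n)%:R : R[i]^o))
    (hr_dual : forall n m : nat,
      series (fun k => r k (t n) * (r k (t m))^*%R : R[i]^o)
        @ \oo --> ((m == n)%:R / (rho (t n))%:C : R[i]^o))
    (hr_compl : complete_system (wl2 (fun j => rho (t j)))
      (wl2_dot (fun j => rho (t j))) (fun n j => r n (t j)))
    (u : nat -> R[i]) (hu : forall k, `|u k| = 1)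
    (x : nat -> R) (hx : forall n, x n = 1 / t n)
    (J : nat -> R -> R[i])
    (hJ_l2 : forall s : R, wl2 (fun=> 1) (fun k => J k s))
    (lambda : nat -> R) (hlambda : forall n, lambda n != 0)
    (hJ_sample : forall k n : nat,
      J k (x n) = (lambda n)%:C * r k (1 / x n))
    (K : R -> L2 mu)
    (hK : forall s : R, hcvg (L2_dot mu)
      (fun n => \sum_(k < n) (J k s * u k) *: p k) (K s)) :
  let F : L2 mu -> R -> R[i] := integral_transform K in
  let dotF := range_dot (L2_dot mu) F in
  [/\ hilbert_iso setT (L2_dot mu) (range F) dotF F,
      is_hilbert (range F) dotF &
      reproducing_kernel (range F) dotF
        (fun s s' => cintegral mu (fun y => K s y * (K s' y)^*%R))].
Proof.
move=> F dotF.
have FE f s : F f s = L2_dot mu f (L2_conj (K s)) by rewrite L2_dot_conjr.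
have hL2 := L2_is_hilbert mu.
have Flin a f g : F (a *: f + g) = a *: F f + F g.
  by apply/funext => s; rewrite FE L2_dotDZl -!FE.
have F_ker f : (forall s, F f s = 0) -> f = 0.
  (* With the conjugate of [f] in the second slot, [<p k, g>] is [\int f p_k] and [<K s, g>] is
     [F f s], so the expansion of [K s] sits in the linear slot. *)
  move=> Ff0; pose g := L2_conj f.
  have Kg s : L2_dot mu (K s) g = 0.
    by rewrite /g L2_dot_conjr_swap -FE.
  have c0 : forall k, u k * L2_dot mu (p k) g = 0.
    apply: (orthonormal_ker (w := fun j => rho (t j))
      (a := fun k j => r k (t j))).
    - by move=> j; exact: ltW.
    - exact: hr_orth.
    - move=> n; apply: le_trans (bessel hL2 hp_orth g n).
      rewrite le_eqVlt; apply/orP; left; apply/eqP; apply: eq_bigr => k _.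
      have := hu k; rewrite normcnorm => -[uk].
      by rewrite cnormM uk mul1r.
    - move=> j.
      have l0 : 0 < `|lambda j| by rewrite normr_gt0.
      have Jx k : J k (x j) = (lambda j)%:C * r k (t j).
        by rewrite hJ_sample hx !div1r invrK.
      pose v n := \sum_(k < n) (J k (x j) * u k) *: p k.
      (* Since [<K (x j), g> = 0] and [J k (x j)] is [lambda j] times [r k (t j)], the sum times
         [lambda j] is [<v n - K (x j), g>]. Cauchy-Schwarz applies, and [lambda j] is nonzero. *)
      have ub n : cnorm (\sum_(k < n) u k * L2_dot mu (p k) g * r k (t j)) <=
          hnorm (L2_dot mu) (v n - K (x j)) *
          (hnorm (L2_dot mu) g / `|lambda j|).
        rewrite mulrA ler_pdivlMr// mulrC.
        rewrite -cnorm_real -cnormM.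
        apply: le_trans (cauchy_schwarz hL2 _ _).
        rewrite (dotBl hL2) Kg subr0 (dot_suml hL2) mulr_sumr.
        rewrite le_eqVlt; apply/orP; left; apply/eqP; congr cnorm.
        by apply: eq_bigr => k _; rewrite (dotZl hL2) Jx; ring.
      apply: (@squeeze_cvgr _ _ _ _ (cst 0)
        (fun n => hnorm (L2_dot mu) (v n - K (x j)) *
          (hnorm (L2_dot mu) g / `|lambda j|))).
      + by apply: nearW => n; rewrite cnorm_ge0 ub.
      + exact: cvg_cst.
      + rewrite -[X in _ --> X](mul0r (hnorm (L2_dot mu) g / `|lambda j|)).
        by apply: cvgM; [exact: hK|exact: cvg_cst].
  (* The unimodular factor [u k] cancels, leaving [g] orthogonal to the complete system. *)
  have g0 : g = 0.
    apply: (complete_ortho_eq0 hL2 hp_compl) => k.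
    have /eqP := c0 k; rewrite mulf_eq0 => /orP[|/eqP//].
    by rewrite -normr_eq0 hu oner_eq0.
  (* Conjugating twice and swapping turns [<f,f>] into [<g,g>]. *)
  apply: (L2_dot_eq0); rewrite -{2}(L2_conjK f) L2_dot_conjr_swap -/g g0.
  exact: (dot0l hL2).
have Finj : injective F.
  move=> f g fg; apply/eqP; rewrite -subr_eq0; apply/eqP; apply: F_ker => s.
  have -> : f - g = (-1) *: g + f by rewrite scaleN1r addrC.
  by rewrite Flin fg scaleN1r addNr.
split.
- exact: range_hilbert_iso.
- exact: range_hilbert.
(* Conjugating both factors reverses their order, which is the form of the abstract kernel with
   [kap s] the conjugate of [K s]. *)
- have kE : (fun s s' => cintegral mu (fun y => K s y * (K s' y)^*%R)) =
      (fun s s' => L2_dot mu (L2_conj (K s')) (L2_conj (K s))).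
    apply/funext => s; apply/funext => s'.
    by rewrite -L2_dot_conjr_swap L2_conjK.
  by rewrite kE; exact: range_reproducing_kernel.
Qed.
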